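(* Let $k$ be a field. The categories $\mathsf{Top}^{\mathsf{sc}}_{\mathbb Z}$ and $\mathsf{Top}^{\mathsf{sc}}_k$ are not left quasi-abelian. In fact, they are not even left semi-abelian.
   Context: All topological abelian groups have linear topology: open subgroups form a base of neighborhoods of zero. All topological $k$-vector spaces ($k$ a fixed field with the discrete topology) have linear topology: open vector subspaces form a base of neighborhoods of zero. The completion of $A$ is $A^{\wedge}=\varprojlim_{U\subset A}A/U$, with $U$ ranging over the open subgroups (resp. subspaces), topologized so that the kernels of the projections $A^{\wedge}\to A/U$ form a base of neighborhoods of zero. $A$ is separated (resp. complete) if the natural map $A\to A^{\wedge}$ is injective (resp. surjective). $\mathsf{Top}^{\mathsf{sc}}_{\mathbb Z}$ (resp. $\mathsf{Top}^{\mathsf{sc}}_k$) is the category of complete, separated topological abelian groups and continuous homomorphisms (resp. complete, separated topological $k$-vector spaces and continuous $k$-linear maps). These are additive categories in which all kernels and cokernels exist. Let $\mathsf A$ be an additive category with kernels and cokernels. A morphism is called a cokernel if it is a cokernel of some morphism. $\mathsf A$ is left quasi-abelian if any pullback of a cokernel is a cokernel. For a morphism $f\colon A\to B$ put $\operatorname{coim}(f)=\operatorname{coker}(\ker(f)\to A)$ and $\operatorname{im}(f)=\ker(B\to\operatorname{coker}(f))$; then $f$ factors naturally as $A\to\operatorname{coim}(f)\to\operatorname{im}(f)\to B$. $\mathsf A$ is left semi-abelian if for every morphism $f$ the natural morphism $\operatorname{coim}(f)\to\operatorname{im}(f)$ is a monomorphism (equivalently: the composition of any two cokernels is a cokernel).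 Any left quasi-abelian category is left semi-abelian. *)

(* Defs.v *)
From HB Require Import structures.
From mathcomp Require Import all_boot all_algebra.
From mathcomp Require Import boolp classical_sets functions topology tvs.

Set Implicit Arguments.
Unset Strict Implicit.
Unset Printing Implicit Defensive.

Import GRing.Theory.
Local Open Scope classical_set_scope.
Local Open Scope ring_scope.

Record preadditive := Preadditive {
  Ob :> Type;
  Mor : Ob -> Ob -> zmodType;
  idm : forall A, Mor A A;
  compm : forall A B C, Mor B C -> Mor A B -> Mor A C;
  compm_idl : forall A B (f : Mor A B), compm (idm B) f = f;
  compm_idr : forall A B (f : Mor A B), compm f (idm A) = f;
  compm_assoc : forall A B C D (h : Mor C D) (g : Mor B C) (f : Mor A B),
    compm h (compm g f) = compm (compm h g) f;
  compmDl : forall A B C (g g' : Mor B C) (f : Mor A B),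
    compm (g + g') f = compm g f + compm g' f;
  compmDr : forall A B C (g : Mor B C) (f f' : Mor A B),
    compm g (f + f') = compm g f + compm g f' }.

Arguments Mor {_} _ _.
Arguments compm {_ _ _ _} _ _.

Notation "g \c f" := (compm g f) (at level 40, left associativity).

Section Notions.
Variable C : preadditive.

Definition is_kernel (K A B : C) (f : Mor A B) (i : Mor K A) :=
  f \c i = 0 /\
  forall X (g : Mor X A), f \c g = 0 -> exists! h : Mor X K, i \c h = g.

Definition is_cokernel (A B Q : C) (f : Mor A B) (p : Mor B Q) :=
  p \c f = 0 /\
  forall X (g : Mor B X), g \c f = 0 -> exists! h : Mor Q X, h \c p = g.

Definition cokernel_morphism (B Q : C) (p : Mor B Q) :=
  exists A (f : Mor A B), is_cokernel f p.

Definition monomorphism (A B : C) (f : Mor A B) :=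
  forall X (g h : Mor X A), f \c g = f \c h -> g = h.

Definition is_pullback (P A B D : C)
    (p : Mor P A) (q : Mor P B) (f : Mor A D) (g : Mor B D) :=
  f \c p = g \c q /\
  forall X (a : Mor X A) (b : Mor X B), f \c a = g \c b ->
    exists! h : Mor X P, p \c h = a /\ q \c h = b.

Definition left_quasi_abelian :=
  forall (P A B D : C)
    (p : Mor P A) (q : Mor P B) (f : Mor A D) (g : Mor B D),
  is_pullback p q f g -> cokernel_morphism g -> cokernel_morphism p.

(* Here [p] exhibits [Coim] as coker(ker f) and [i] exhibits [Im] as
   ker(coker f). As [p] is epi and [i] is mono, the equation on [m] determines
   it: it is the natural morphism. All choices of kernels and cokernels are
   quantified over, so that the definition makes sense without assuming that
   they exist. *)
Definition left_semi_abelian :=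
  forall (A B : C) (f : Mor A B)
    (K : C) (k : Mor K A) (Coim : C) (p : Mor A Coim)
    (Q : C) (c : Mor B Q) (Im : C) (i : Mor Im B) (m : Mor Coim Im),
  is_kernel f k -> is_cokernel k p ->
  is_cokernel f c -> is_kernel c i ->
  i \c (m \c p) = f ->
  monomorphism m.

End Notions.

(* The quotient A/U is the set of cosets of U. For U contained in V, the
   canonical map A/U -> A/V sends a coset of U to the coset of V containing it,
   so a family in the product of the A/U over U in S belongs to their
   projective limit iff it is monotone for inclusion. *)
Section Completion.
Variables (A : zmodType) (S : set (set A)).

Definition add_coset (U : set A) (a : A) : set A := [set x | U (x - a)].

Definition add_quotient (U : set A) :=
  {c : set A | exists a, c = add_coset U a}.

Definition add_proj (U : set A) (a : A) : add_quotient U :=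
  exist _ (add_coset U a) (ex_intro _ a erefl).

Definition completion :=
  {x : forall U : {U : set A | S U}, add_quotient (sval U) |
   forall U V, sval U `<=` sval V -> sval (x U) `<=` sval (x V)}.

Lemma add_proj_compat a (U V : {U : set A | S U}) :
  sval U `<=` sval V ->
  sval (add_proj (sval U) a) `<=` sval (add_proj (sval V) a).
Proof. by move=> UV x; apply: UV. Qed.

Definition to_completion (a : A) : completion :=
  exist _ (fun U : {U : set A | S U} => add_proj (sval U) a)
          (@add_proj_compat a).

Definition completion_separated := injective to_completion.

Definition completion_complete :=
  forall x : completion, exists a, to_completion a = x.

End Completion.

Definition base_at_zero (A : topologicalZmodType) (S : set (set A)) :=
  forall W : set A, nbhs (0 : A) W -> exists2 U, S U & U `<=` W.

Definition open_subgroup (A : topologicalZmodType) : set (set A) :=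
  [set U : set A | open U /\ zmod_closed [in U]].

Record topscZ := TopscZ {
  topscZ_sort :> topologicalZmodType;
  topscZ_linear : base_at_zero (@open_subgroup topscZ_sort);
  topscZ_separated : completion_separated (@open_subgroup topscZ_sort);
  topscZ_complete : completion_complete (@open_subgroup topscZ_sort) }.

(* The library's [topologicalLmodType] requires a [numDomainType] of scalars,
   so topological vector spaces over an arbitrary discrete field are bundled
   here from [topologicalZmodType] and the module structure. *)
Record topLmod (k : fieldType) := TopLmod {
  topLmod_sort :> topologicalZmodType;
  topLmod_scale : GRing.Zmodule_isLmodule k topLmod_sort }.

HB.instance Definition _ (k : fieldType) (V : topLmod k) := topLmod_scale V.

Record topVect (k : fieldType) := TopVect {
  topVect_sort :> topLmod k;
  topVect_scale_continuous : continuous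
    (fun x : discrete_topology k * topVect_sort => (x.1 : k) *: x.2) }.

Definition open_subspace (k : fieldType) (V : topVect k) : set (set V) :=
  [set U : set V | open U /\ GRing.submod_closed [in U]].

Record topscK (k : fieldType) := TopscK {
  topscK_sort :> topVect k;
  topscK_linear : base_at_zero (@open_subspace k topscK_sort);
  topscK_separated : completion_separated (@open_subspace k topscK_sort);
  topscK_complete : completion_complete (@open_subspace k topscK_sort) }.

Lemma continuousB (A B : topologicalZmodType) (f g : A -> B) :
  continuous f -> continuous g -> continuous (fun x => f x - g x).
Proof.
move=> fC gC x.
apply: (@continuous_comp A _ B (fun t => (f t, g t))
          (fun z : B * B => z.1 - z.2)).
  by apply: cvg_pair; [exact: fC|exact: gC].
exact: sub_continuous.
Qed.

Section HomZ.
Variables A B : topologicalZmodType.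

Definition cont_additive : {pred A -> B} :=
  [pred f : A -> B | `[< zmod_morphism f /\ continuous f >]].

Lemma cont_additiveP (f : A -> B) :
  reflect (zmod_morphism f /\ continuous f) (f \in cont_additive).
Proof. exact: asboolP. Qed.

Lemma cont_additive_zmod_closed : zmod_closed cont_additive.
Proof.
split=> [|f g].
  by apply/cont_additiveP; split=> [x y|x];
    [rewrite subr0|exact: cvg_cst].
move=> /cont_additiveP[fD fC] /cont_additiveP[gD gC].
apply/cont_additiveP; split=> [x y|]; last exact: continuousB.
rewrite -[LHS]/(f (x - y) - g (x - y)) fD gD.
by rewrite -[RHS]/(f x - g x - (f y - g y)) !opprD !opprK addrACA.
Qed.

HB.instance Definition _ := GRing.isZmodClosed.Build (A -> B)
  cont_additive cont_additive_zmod_closed.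

Record homZ := HomZ {
  homZ_fun :> A -> B;
  homZ_spec : homZ_fun \in cont_additive }.

HB.instance Definition _ := [isSub for homZ_fun].
HB.instance Definition _ := [Choice of homZ by <:].
HB.instance Definition _ := [SubChoice_isSubZmodule of homZ by <:].

End HomZ.

Section HomK.
Variables (k : fieldType) (A B : topLmod k).

Definition cont_linear : {pred A -> B} :=
  [pred f : A -> B | `[< linear f /\ continuous f >]].

Lemma cont_linearP (f : A -> B) :
  reflect (linear f /\ continuous f) (f \in cont_linear).
Proof. exact: asboolP. Qed.

Lemma cont_linear_zmod_closed : zmod_closed cont_linear.
Proof.
split=> [|f g].
  by apply/cont_linearP; split=> [a x y|x];
    [rewrite scaler0 addr0|exact: cvg_cst].
move=> /cont_linearP[fL fC] /cont_linearP[gL gC].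
apply/cont_linearP; split=> [a x y|]; last exact: continuousB.
rewrite -[LHS]/(f (a *: x + y) - g (a *: x + y)) fL gL.
by rewrite -[RHS]/(a *: (f x - g x) + (f y - g y)) scalerBr opprD addrACA.
Qed.

HB.instance Definition _ := GRing.isZmodClosed.Build (A -> B)
  cont_linear cont_linear_zmod_closed.

Record homK := HomK {
  homK_fun :> A -> B;
  homK_spec : homK_fun \in cont_linear }.

HB.instance Definition _ := [isSub for homK_fun].
HB.instance Definition _ := [Choice of homK by <:].
HB.instance Definition _ := [SubChoice_isSubZmodule of homK by <:].

End HomK.

Lemma idZ_spec (A : topologicalZmodType) : idfun \in @cont_additive A A.
Proof. by apply/cont_additiveP; split=> // x; exact: cvg_id. Qed.

Lemma compZ_spec (A B C : topologicalZmodType) (g : homZ B C) (f : homZ A B) :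
  (g \o f) \in @cont_additive A C.
Proof.
have /cont_additiveP[gD gC] := homZ_spec g.
have /cont_additiveP[fD fC] := homZ_spec f.
apply/cont_additiveP; split=> [x y|x] /=; first by rewrite fD gD.
by apply: continuous_comp; [exact: fC|exact: gC].
Qed.

Definition idZ A := HomZ (idZ_spec A).
Definition compZ A B C (g : homZ B C) (f : homZ A B) := HomZ (compZ_spec g f).

Lemma compZ_idl A B (f : homZ A B) : compZ (idZ B) f = f.
Proof. exact/val_inj. Qed.

Lemma compZ_idr A B (f : homZ A B) : compZ f (idZ A) = f.
Proof. exact/val_inj. Qed.

Lemma compZ_assoc A B C D (h : homZ C D) (g : homZ B C) (f : homZ A B) :
  compZ h (compZ g f) = compZ (compZ h g) f.
Proof. exact/val_inj. Qed.

Lemma compZDl A B C (g g' : homZ B C) (f : homZ A B) :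
  compZ (g + g') f = compZ g f + compZ g' f.
Proof. exact/val_inj. Qed.

Lemma compZDr A B C (g : homZ B C) (f f' : homZ A B) :
  compZ g (f + f') = compZ g f + compZ g f'.
Proof.
apply/val_inj/funext => x /=.
have /cont_additiveP[gB _] := homZ_spec g.
have g0 : g 0 = 0 by rewrite -[X in g X](subrr 0) gB subrr.
have gN y : g (- y) = - g y by rewrite -[X in g X]sub0r gB g0 sub0r.
rewrite -[LHS]/(g (f x + f' x)) -[RHS]/(g (f x) + g (f' x)).
by rewrite -[X in g (_ + X)]opprK gB gN opprK.
Qed.

Definition TopZ_sc : preadditive :=
  @Preadditive topscZ (fun A B => homZ A B) (fun A => idZ A)
    (fun A B C g f => compZ g f) (fun A B f => compZ_idl f)
    (fun A B f => compZ_idr f) (fun A B C D h g f => compZ_assoc h g f)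
    (fun A B C g g' f => compZDl g g' f) (fun A B C g f f' => compZDr g f f').

Section CategoryK.
Variable k : fieldType.
Implicit Types A B C D : topLmod k.

Lemma idK_spec A : idfun \in @cont_linear k A A.
Proof. by apply/cont_linearP; split=> // x; exact: cvg_id. Qed.

Lemma compK_spec A B C (g : homK B C) (f : homK A B) :
  (g \o f) \in @cont_linear k A C.
Proof.
have /cont_linearP[gL gC] := homK_spec g.
have /cont_linearP[fL fC] := homK_spec f.
apply/cont_linearP; split=> [a x y|x] /=; first by rewrite fL gL.
by apply: continuous_comp; [exact: fC|exact: gC].
Qed.

Definition idK A := HomK (idK_spec A).
Definition compK A B C (g : homK B C) (f : homK A B) := HomK (compK_spec g f).

Lemma compK_idl A B (f : homK A B) : compK (idK B) f = f.
Proof. exact/val_inj. Qed.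

Lemma compK_idr A B (f : homK A B) : compK f (idK A) = f.
Proof. exact/val_inj. Qed.

Lemma compK_assoc A B C D (h : homK C D) (g : homK B C) (f : homK A B) :
  compK h (compK g f) = compK (compK h g) f.
Proof. exact/val_inj. Qed.

Lemma compKDl A B C (g g' : homK B C) (f : homK A B) :
  compK (g + g') f = compK g f + compK g' f.
Proof. exact/val_inj. Qed.

Lemma compKDr A B C (g : homK B C) (f f' : homK A B) :
  compK g (f + f') = compK g f + compK g f'.
Proof.
apply/val_inj/funext => x /=.
have /cont_linearP[gL _] := homK_spec g.
rewrite -[LHS]/(g (f x + f' x)) -[RHS]/(g (f x) + g (f' x)).
by rewrite -[f x in LHS]scale1r gL scale1r.
Qed.

Definition TopK_sc : preadditive :=
  @Preadditive (topscK k) (fun U V => homK U V) (fun U => idK U)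
    (fun U V W g f => compK g f) (fun U V f => compK_idl f)
    (fun U V f => compK_idr f) (fun U V W X h g f => compK_assoc h g f)
    (fun U V W g g' f => compKDl g g' f) (fun U V W g f f' => compKDr g f f').

End CategoryK.

(* Main.v *)
Require Import Defs.
From HB Require Import structures.
From mathcomp Require Import all_boot all_algebra.
From mathcomp Require Import boolp classical_sets functions cardinality fsbigop.
From mathcomp Require Import topology tvs.

Set Implicit Arguments.
Unset Strict Implicit.
Unset Printing Implicit Defensive.

Import GRing.Theory.
Local Open Scope classical_set_scope.
Local Open Scope ring_scope.

(** Write [A/K] for the quotient of [A] by a closed subgroup [K]. In the
    category of complete separated groups the cokernel of [K -> A] is not [A/K]
    but its completion, and [A/K] may fail to be complete when zero has no
    countable base of neighborhoods in [A]. So a cokernel [p : A -> D] need not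
    be surjective, and a nonzero subgroup [L] of [D] may meet the image of [p]
    in zero only. Let [m : D -> B] have kernel [L]. Then [m p] and [p] have the
    same kernel [K], so the coimage of [m p] is [D]; if [m] is onto, the image
    of [m p] is [B], and the natural morphism is [m], which is not mono. The
    pullback of [p] along [L -> D] is the zero morphism [K -> L], which is not
    epi. This argument is valid in any preadditive category
    ([counterexample_not_semi_abelian] and [counterexample_not_quasi_abelian]).

    For the data, let [I] be an uncountable set, and let [A] be the space of
    finitely supported functions [I * nat -> k], where a neighborhood of zero
    consists of the functions that vanish on a given thin set, that is, on a
    subset of the union of the columns [I * {m}] with [m < n], for some [n], and
    of a countable set. Two opposite properties of thin sets are used.
    - There are enough of them for [A] to be complete: the limit of a Cauchy
      family is finitely supported on every countable set, hence finitely
      supported ([finsupp_local]).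
    - Each of them leaves, for some [i], the row [{i} * nat] free
      except for finitely many points ([thin_free_row]). Hence summation over
      [I] is an open map of [A] onto the space of finitely supported sequences,
      with the topology of the product [k^nat].

    The space of finitely supported sequences is not complete; its completion
    is [D = k^nat], and [p : A -> D], the summation over [I], is the cokernel of
    its kernel ([sum_cokernel]). The constant sequences form a line [L] in [D]
    that meets the image of [p] in zero only, and the difference operator
    [m : D -> D] is onto with kernel [L].

    All universal properties are proved for topological groups. The vector
    space case follows: a continuous additive map that is uniquely determined by
    a condition compatible with scalars is linear
    ([forget_reflects_kernel], [forget_reflects_cokernel]). *)

(** * Failure of both properties in a preadditive category *)

Section ZeroAndEpi.
Variable C : preadditive.

Lemma compm0 (X Y Z : C) (g : Mor Y Z) : g \c (0 : Mor X Y) = 0.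
Proof. by apply: (addrI (g \c 0)); rewrite -compmDr !addr0. Qed.

Lemma comp0m (X Y Z : C) (f : Mor X Y) : (0 : Mor Y Z) \c f = 0.
Proof. by apply: (addrI (0 \c f)); rewrite -compmDl !addr0. Qed.

Definition epimorphism (X Y : C) (f : Mor X Y) :=
  forall Z (g h : Mor Y Z), g \c f = h \c f -> g = h.

Lemma cokernel_epi (X Y Z : C) (f : Mor X Y) (p : Mor Y Z) :
  is_cokernel f p -> epimorphism p.
Proof.
move=> [pf0 pU] T g h gh.
have [|u [_ uU]] := pU T (h \c p); first by rewrite -compm_assoc pf0 compm0.
by rewrite -(uU g gh) -(uU h erefl).
Qed.

End ZeroAndEpi.

(** The coimage of [ce_m \c ce_p] is [ce_D], because [ce_k] is a kernel of both
    [ce_p] and the composite, while its image is the whole of [ce_B]. The object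
    [ce_Z] is a zero object, needed as the cokernel of an epimorphism. *)
Record coimage_counterexample (C : preadditive) := CoimageCounterexample {
  ce_K : C; ce_A : C; ce_D : C; ce_B : C; ce_L : C; ce_Z : C;
  ce_k : Mor ce_K ce_A;
  ce_p : Mor ce_A ce_D;
  ce_m : Mor ce_D ce_B;
  ce_l : Mor ce_L ce_D;
  ce_coker : is_cokernel ce_k ce_p;
  ce_ker : is_kernel (ce_m \c ce_p) ce_k;
  ce_epi : epimorphism ce_m;
  ce_mono : monomorphism ce_l;
  ce_ml : ce_m \c ce_l = 0;
  ce_L_neq0 : idm ce_L <> 0;
  ce_Z_eq0 : idm ce_Z = 0 }.

Lemma counterexample_not_semi_abelian (C : preadditive) :
  coimage_counterexample C -> ~ left_semi_abelian C.
Proof.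
case=> K A D B L Z k p m l cok ker epi mono ml L0 Z0 semi.
have mmono : monomorphism m.
  apply: (semi A B (m \c p) K k D p Z 0 B (idm B) m ker cok _ _ _).
  - split=> [|X g gmp]; first by rewrite comp0m.
    exists 0; split=> [|h _]; last by rewrite -[h]compm_idr Z0 compm0.
    apply/esym; rewrite comp0m; apply: epi; apply: (cokernel_epi cok).
    by rewrite -compm_assoc gmp !comp0m.
  - split=> [|X g _]; first by rewrite comp0m.
    by exists g; split=> [|h <-]; rewrite compm_idl.
  - by rewrite compm_idl.
have l0 : l = 0 by apply: mmono; rewrite ml compm0.
by apply/L0/mono; rewrite l0 !comp0m.
Qed.

(** Over a pair [(a, b)] with [l a = p b] one has [m p b = m l a = 0], so [b]
    factors through [k] and [l a = 0]. So the pullback of [l] and [p] is [K],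
    with the zero projection to [L]. *)
Lemma counterexample_not_quasi_abelian (C : preadditive) :
  coimage_counterexample C -> ~ left_quasi_abelian C.
Proof.
case=> K A D B L Z k p m l cok ker epi mono ml L0 Z0 quasi.
have [pk0 _] := cok; have [_ kU] := ker.
have pull : is_pullback (0 : Mor K L) k l p.
  split=> [|X a b lapb]; first by rewrite compm0 pk0.
  have [|h [kh hU]] := kU X b.
    by rewrite -compm_assoc -lapb compm_assoc ml comp0m.
  exists h; split=> [|h' [_ kh']]; last exact: hU.
  split=> //; apply: mono.
  by rewrite lapb comp0m compm0 -kh compm_assoc pk0 comp0m.
have p_cok : cokernel_morphism p by exists K, k.
have [X [f cok0]] := quasi _ _ _ _ _ _ _ _ pull p_cok.
by apply: L0; apply: (cokernel_epi cok0); rewrite !compm0.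
Qed.

(** * Complete spaces of functions *)

Lemma sig_ext T (P : T -> Prop) (x y : {z | P z}) : sval x = sval y -> x = y.
Proof. by apply: eq_sig_hprop => z; exact: Prop_irrelevance. Qed.

Lemma add_coset_eq (A : zmodType) (U : set A) (a b : A) :
  zmod_closed [in U] -> U (a - b) -> add_coset U a = add_coset U b.
Proof.
move=> [/set_mem U0 UB] Uab.
have {}UB y z : U y -> U z -> U (y - z).
  by move=> Uy Uz; apply/set_mem/UB; apply: mem_set.
have Uba : U (b - a) by rewrite -opprB -sub0r; apply: UB.
apply/seteqP; split=> x Ux; rewrite /add_coset/=.
  by rewrite -(subrK a x) -addrA -[a - b]opprB; apply: UB.
by rewrite -(subrK b x) -addrA -[b - a]opprB; apply: UB.
Qed.

(** A space of functions on [pts], where a neighborhood of zero consists of the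
    functions that vanish on a test set. The condition [fns_local] is exactly
    what completeness needs: a Cauchy family prescribes a function whose
    restriction to each test set extends to an element of the space. *)
Record fun_spec (k : fieldType) := FunSpec {
  pts : Type;
  tests : set (set pts);
  fns : {pred (pts -> k^o)};
  tests_nonempty : tests !=set0;
  testsU : forall D E, tests D -> tests E -> tests (D `|` E);
  tests_cover : forall x, exists2 D, tests D & D x;
  fns_submod : submod_closed fns;
  fns_local : forall f, (forall D, tests D ->
    exists2 g, g \in fns & {in D, g =1 f}) -> f \in fns }.

HB.instance Definition _ k (s : fun_spec k) :=
  GRing.isSubmodClosed.Build k (pts s -> k^o) (@fns k s) (fns_submod s).

Record fspace k (s : fun_spec k) := Fspace {
  fval :> pts s -> k^o;
  fvalP : fval \in @fns k s }.

HB.instance Definition _ k (s : fun_spec k) := [isSub for @fval k s].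
HB.instance Definition _ k (s : fun_spec k) := [Choice of fspace s by <:].
HB.instance Definition _ k (s : fun_spec k) :=
  [SubChoice_isSubLmodule of fspace s by <:].

Section Topology.
Variables (k : fieldType) (s : fun_spec k).
Implicit Types (f g : fspace s) (D : set (pts s)) (W : set (fspace s)).

Definition fnbhs f : set (set (fspace s)) :=
  [set W | exists2 D, tests D & forall g, {in D, g =1 f} -> W g].

HB.instance Definition _ := hasNbhs.Build (fspace s) fnbhs.

Lemma fnbhs_filter f : ProperFilter (nbhs f).
Proof.
apply: Build_ProperFilter_ex => [W [D _ DW]|]; first by exists f; apply: DW.
split=> [|V W [D tD DV] [E tE EW]|V W VW [D tD DV]].
- by have [D tD] := tests_nonempty s; exists D.
- exists (D `|` E) => [|g gf]; first exact: testsU.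
  by split; [apply: DV|apply: EW] => x xD; apply: gf;
     move: xD; rewrite !inE; [left|right].
- by exists D => // g gf; apply/VW/DV.
Qed.

Lemma fnbhs_singleton f W : nbhs f W -> W f.
Proof. by case=> D _; apply. Qed.

Lemma fnbhs_nbhs f W : nbhs f W -> nbhs f (nbhs^~ W).
Proof.
case=> D tD DW; exists D => // g gf; exists D => // h hg.
by apply: DW => x xD; rewrite hg ?gf.
Qed.

HB.instance Definition _ := Nbhs_isNbhsTopological.Build (fspace s)
  fnbhs_filter fnbhs_singleton fnbhs_nbhs.

Lemma fspace_sub_continuous :
  continuous (fun u : fspace s * fspace s => u.1 - u.2).
Proof.
move=> [f g] W [D tD DW].
exists ([set f' : fspace s | {in D, f' =1 f}],
        [set g' : fspace s | {in D, g' =1 g}]).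
  by split; exists D.
move=> [f' g'] [/= ff gg]; apply: DW => x xD /=.
by rewrite -[LHS]/(f' x - g' x) ff ?gg.
Qed.

HB.instance Definition _ :=
  PreTopologicalNmodule_isTopologicalZmodule.Build (fspace s)
    fspace_sub_continuous.

Definition fspace_topLmod : topLmod k :=
  @TopLmod k (fspace s) (GRing.Zmodule_isLmodule.Build k (fspace s)
    (@scalerA _ _) (@scale1r _ _) (@scalerDr _ _)
    (@scalerDl _ _)).

Lemma fspace_scale_continuous :
  continuous (fun x : discrete_topology k * fspace_topLmod =>
    (x.1 : k) *: x.2).
Proof.
move=> [a f] W [D tD DW].
exists ([set a], [set f' : fspace s | {in D, f' =1 f}]).
  by split; [rewrite nbhs_principalE|exists D].
move=> [a' f'] [/= -> ff]; apply: DW => x xD.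
by rewrite -[LHS]/(a *: f' x) ff.
Qed.

Definition fspace_topVect : topVect k := TopVect fspace_scale_continuous.

Definition vanishing D : set fspace_topVect :=
  [set f | {in D, forall x, (f : fspace s) x = 0}].

Lemma vanishing_open D : tests D -> open_subspace (vanishing D).
Proof.
move=> tD; split.
  by move=> f fD; exists D => // g gf x xD; rewrite gf ?fD.
split=> [|a f g]; rewrite !inE; first by move=> x _.
move=> fD gD x xD; rewrite -[LHS]/(a *: (f : fspace s) x + (g : fspace s) x).
by rewrite fD ?gD // scaler0 addr0.
Qed.

Lemma vanishing_nbhs0 D : tests D -> nbhs (0 : fspace s) (vanishing D).
Proof. by move=> tD; exists D. Qed.

Lemma nbhs0_vanishing W : nbhs (0 : fspace s) W ->
  exists2 D, tests D & vanishing D `<=` W.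
Proof. by case=> D tD DW; exists D. Qed.

Lemma fspace_linear : base_at_zero (@open_subspace k fspace_topVect).
Proof.
move=> W /nbhs0_vanishing[D tD DW].
by exists (vanishing D) => //; exact: vanishing_open.
Qed.

Lemma fspace_separated :
  completion_separated (@open_subspace k fspace_topVect).
Proof.
move=> f g fg; apply/val_inj/funext => x.
have [D tD Dx] := tests_cover x.
have oD := vanishing_open tD.
have : sval (sval (to_completion (@open_subspace k fspace_topVect) g)
  (exist _ _ oD)) f by rewrite -fg /= => y _ /=; rewrite subrr.
by move=> /(_ x (mem_set Dx)) /eqP; rewrite subr_eq0 => /eqP.
Qed.

(** A point of the completion gives, for each test set [D], a function [r D]
    that is determined on [D]; the functions agree where they are determined,
    since the union of two test sets is a test set. They glue to an element of
    the space by [fns_local]. *)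
Lemma fspace_complete :
  completion_complete (@open_subspace k fspace_topVect).
Proof.
move=> [c c_mono].
have r_ex (Dt : {D | tests D}) : exists f : fspace s,
    sval (c (exist _ _ (vanishing_open (svalP Dt)))) =
    add_coset (vanishing (sval Dt)) f.
  have [f ->] := svalP (c (exist _ _ (vanishing_open (svalP Dt)))).
  by exists f.
pose r Dt : fspace s := sval (cid (r_ex Dt)).
have rP Dt : sval (c (exist _ _ (vanishing_open (svalP Dt)))) =
    add_coset (vanishing (sval Dt)) (r Dt) := svalP (cid (r_ex Dt)).
have r_sub (Dt Et : {D | tests D}) : sval Dt `<=` sval Et ->
    {in sval Dt, r Et =1 r Dt}.
  move=> DE x xD; apply/eqP; rewrite -subr_eq0; apply/eqP.
  have VED : vanishing (sval Et) `<=` vanishing (sval Dt).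
    by move=> f fE y /set_mem/DE/mem_set/fE.
  have := @c_mono (exist _ _ (vanishing_open (svalP Et)))
    (exist _ _ (vanishing_open (svalP Dt))) VED.
  rewrite !rP => /(_ (r Et)); apply=> // y _.
  by rewrite -[LHS]/(r Et y - r Et y) subrr.
pose Dx (x : pts s) : {D | tests D} :=
  let Dp := cid2 (tests_cover x) in exist _ (s2val Dp) (s2valP Dp).
have DxP (x : pts s) : sval (Dx x) x by rewrite /Dx /=; case: cid2.
pose f (x : pts s) := r (Dx x) x.
have rf Dt : {in sval Dt, r Dt =1 f}.
  move=> x xD; pose Et : {D | tests D} :=
    exist _ _ (testsU (svalP Dt) (svalP (Dx x))).
  rewrite /f -(r_sub Dt Et) //; last exact: subsetUl.
  by rewrite -(r_sub (Dx x) Et) ?inE //; exact: subsetUr.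
have fP : f \in @fns k s.
  apply: fns_local => D tD; exists (r (exist _ D tD)); first exact: fvalP.
  exact: (rf (exist _ D tD)).
exists (Fspace fP); apply: sig_ext; apply: functional_extensionality_dep => U.
apply: sig_ext => /=.
have [D tD DU] : exists2 D, tests D & vanishing D `<=` sval U.
  apply: nbhs0_vanishing; have [Uo [U0 _]] := svalP U.
  by apply: open_nbhs_nbhs; split=> //; apply: set_mem.
pose Dt : {D | tests D} := exist _ D tD.
have : sval (c U) (Fspace fP).
  have := @c_mono (exist _ _ (vanishing_open (svalP Dt))) U DU.
  rewrite rP; apply=> x xD.
  by rewrite -[LHS]/(f x - r Dt x) rf // subrr.
case: (svalP (c U)) => g -> fg; apply: add_coset_eq => //.
exact: GRing.submod_closedB (svalP U).2.
Qed.

Definition fspace_topsc : topscK k :=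
  TopscK fspace_linear fspace_separated fspace_complete.

End Topology.

(** * Completeness and cofinal families *)

Lemma completion_separated_sub (A : zmodType) (S T : set (set A)) :
  S `<=` T -> completion_separated S -> completion_separated T.
Proof.
move=> ST sepS a b abT; apply: sepS.
apply: sig_ext; apply: functional_extensionality_dep => -[U SU].
have /(congr1 (fun x => sval x (exist _ U (ST _ SU)))) := abT.
by move=> /(congr1 (@sval _ _)) ab; apply: sig_ext.
Qed.

(** Open subspaces are cofinal among open subgroups, so this transfers
    completeness from topological vector spaces to topological groups. *)
Lemma completion_complete_sub (A : zmodType) (S T : set (set A)) :
  S `<=` T -> (forall U, T U -> zmod_closed [in U]) ->
  (forall U, T U -> exists2 V, S V & V `<=` U) ->
  completion_complete S -> completion_complete T.
Proof.
move=> ST Tsub cof compS [c c_mono].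
pose lift (V : {V | S V}) : {U | T U} := exist _ (sval V) (ST _ (svalP V)).
have cS_mono (U V : {V | S V}) : sval U `<=` sval V ->
    sval (c (lift U)) `<=` sval (c (lift V)).
  exact: (@c_mono (lift U) (lift V)).
pose cS : completion S := @exist (forall V : {V | S V}, add_quotient (sval V)) _
  (fun V => c (lift V)) cS_mono.
have [a aE] := compS cS; exists a.
apply: sig_ext; apply: functional_extensionality_dep => U.
apply: sig_ext => /=.
have [V SV VU] := cof _ (svalP U).
pose VS : {V | S V} := exist _ V SV.
have : sval (c U) a.
  apply: (c_mono (lift VS) U VU).
  have <- : sval (sval cS VS) = sval (c (lift VS)) by [].
  rewrite -aE /= /add_coset /= subrr.
  have [/set_mem+ _] := Tsub _ (ST _ SV).
  exact.
case: (svalP (c U)) => b -> Ub; apply: add_coset_eq => //.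
exact: Tsub (svalP U).
Qed.

(** * Extension of homomorphisms from a dense image *)

Section HomZTheory.
Variables (A B : topologicalZmodType) (f : homZ A B).

Lemma homZB x y : f (x - y) = f x - f y.
Proof. by have /cont_additiveP[] := homZ_spec f. Qed.

Lemma homZ0 : f 0 = 0.
Proof. by rewrite -[X in f X](subrr 0) homZB subrr. Qed.

Lemma homZ_continuous : continuous f.
Proof. by have /cont_additiveP[] := homZ_spec f. Qed.

End HomZTheory.

Lemma homZ_ext (A B : topologicalZmodType) (f g : homZ A B) : f =1 g -> f = g.
Proof. by move=> fg; apply/val_inj/funext. Qed.

Lemma open_subgroupP (A : topologicalZmodType) (U : set A) : open_subgroup U ->
  [/\ nbhs (0 : A) U, U 0 & forall x y, U x -> U y -> U (x - y)].
Proof.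
move=> [Uo [/set_mem U0 UB]]; split=> //; first exact: open_nbhs_nbhs.
by move=> x y Ux Uy; apply/set_mem/UB; apply/mem_set.
Qed.

Lemma open_subgroupD (A : topologicalZmodType) (U : set A) x y :
  open_subgroup U -> U x -> U y -> U (x + y).
Proof.
move=> /open_subgroupP[_ U0 UB] Ux Uy.
by rewrite -[y]opprK; apply: (UB) => //; rewrite -sub0r; apply: (UB).
Qed.

Lemma nbhs_translate (A : topologicalZmodType) (x y : A) (V : set A) :
  nbhs (x - y) V -> nbhs x [set z | V (z - y)].
Proof.
exact: (@continuousB A A idfun (cst y) (fun z => @cvg_id _ _)
  (fun z => @cvg_cst _ _ _ _ _)).
Qed.

Lemma additive_continuous (A B : topologicalZmodType) (f : A -> B) :
  zmod_morphism f ->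
  (forall V, nbhs (0 : B) V -> nbhs (0 : A) (f @^-1` V)) -> continuous f.
Proof.
move=> fB f0 x V fxV.
have : nbhs (0 : B) [set u | V (u - - f x)].
  by apply: nbhs_translate; rewrite sub0r opprK.
move=> /f0 V0; have := @nbhs_translate A x x _; rewrite subrr => /(_ _ V0).
by apply: filterS => z; rewrite /= fB opprK subrK.
Qed.

Lemma separated_eq (Y : topscZ) (y z : Y) :
  (forall U, open_subgroup U -> U (y - z)) -> y = z.
Proof.
move=> yz; apply: (topscZ_separated (t := Y)).
apply: sig_ext; apply: functional_extensionality_dep => U.
apply: sig_ext => /=; apply: add_coset_eq; last exact: yz (svalP U).
exact: (svalP U).2.
Qed.

(** The hypotheses say that [p] has dense image and that [g] factors through
    that image by a map that is continuous for the topology induced from [D]. As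
    [Y] is complete and separated, the factorization extends to [D]. Its graph
    is the closure of the set of the [(p a, g a)]; additivity and uniqueness are
    immediate from this description. *)
Section Extension.
Variables (A D Y : topscZ) (p : homZ A D) (g : homZ A Y).
Hypothesis p_dense : forall x W, nbhs (0 : D) W -> exists a, W (p a - x).
Hypothesis g_cont : forall U, open_subgroup U ->
  exists2 W, nbhs (0 : D) W & forall a, W (p a) -> U (g a).

Definition graph_closure (x : D) (y : Y) :=
  forall W U, nbhs (0 : D) W -> open_subgroup U ->
  exists2 a, W (p a - x) & U (g a - y).

Definition controls (U : set Y) (W : set D) :=
  open_subgroup W /\ forall a, W (p a) -> U (g a).

Lemma controls_ex U : open_subgroup U -> exists W, controls U W.
Proof.
move=> /g_cont[W /(topscZ_linear (t := D))[V oV VW] Wg].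
by exists V; split=> // a /VW/Wg.
Qed.

Lemma controls_close U W a b x : controls U W ->
  W (p a - x) -> W (p b - x) -> U (g a - g b).
Proof.
move=> [/open_subgroupP[_ _ WB] Wg] Wa Wb; rewrite -homZB; apply: Wg.
have -> : p (a - b) = (p a - x) - (p b - x) by rewrite homZB opprB addrA subrK.
exact: WB.
Qed.

Lemma graph_closure_unique x y z :
  graph_closure x y -> graph_closure x z -> y = z.
Proof.
move=> xy xz; apply: separated_eq => U oU; have [W UW] := controls_ex oU.
have [U0 _ UB] := open_subgroupP oU.
have [W0 _ _] := open_subgroupP UW.1.
have [a Wa Ua] := xy W U W0 oU; have [b Wb Ub] := xz W U W0 oU.
have Uab := controls_close UW Wa Wb.
have -> : y - z = ((g a - g b) + (g b - z)) - (g a - y).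
  by rewrite subrKA opprB [RHS]addrC subrKA.
by apply: (UB) => //; apply: open_subgroupD.
Qed.

(** For each [U], the [g a] with [p a] close to [x] lie in one coset of [U].
    Allowing every [W] that controls [U], and not a chosen one, makes this coset
    monotone in [U], so that the cosets form a point of the completion. *)
Lemma graph_closure_total x : exists y, graph_closure x y.
Proof.
pose c (U : set Y) : set Y :=
  [set y | exists2 W, controls U W & exists2 a, W (p a - x) & U (y - g a)].
have cE (U : {U : set Y | open_subgroup U}) :
    exists a, c (sval U) = add_coset (sval U) a.
  have [_ U0 UB] := open_subgroupP (svalP U).
  have [W UW] := controls_ex (svalP U).
  have [W0 _ _] := open_subgroupP UW.1.
  have [a Wa] := p_dense x W0.
  exists (g a); apply/seteqP; split=> y; last first.
    by move=> Uy; exists W => //; exists a.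
  move=> [V UV [b Vb Uyb]].
  have [V0 _ _] := open_subgroupP UV.1.
  have [d [Wd Vd]] := p_dense x (filterI W0 V0).
  have Uad := controls_close UW Wa Wd.
  have Udb := controls_close UV Vd Vb.
  rewrite /add_coset /=.
  have -> : y - g a = (y - g b) - (g d - g b) - (g a - g d).
    by rewrite opprB addrA subrK opprB addrA subrK.
  by apply: (UB) => //; apply: (UB).
have c_mono (U V : {U : set Y | open_subgroup U}) : sval U `<=` sval V ->
    c (sval U) `<=` c (sval V).
  move=> UV y [W [oW Wg] [a Wa Uya]].
  by exists W; [split=> // b /Wg/UV|exists a => //; exact: UV].
have [y yE] := topscZ_complete (t := Y)
  (exist _ (fun U => exist _ (c (sval U)) (cE U)) c_mono).
exists y => W U W0 oU.
have : c U y.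
  have := congr1 (fun z => sval (sval z (exist _ U oU))) yE.
  by move=> /= <-; rewrite /add_coset /= subrr; have [] := open_subgroupP oU.
move=> [V UV [a Va Uya]].
have [_ U0 UB] := open_subgroupP oU.
have [V0 _ _] := open_subgroupP UV.1.
have [d [Wd Vd]] := p_dense x (filterI W0 V0).
exists d => //.
have -> : g d - y = (g d - g a) - (y - g a) by rewrite opprB addrA subrK.
by apply: (UB) => //; apply: controls_close UV Vd Va.
Qed.

Lemma graph_closureB x y x' y' : graph_closure x y -> graph_closure x' y' ->
  graph_closure (x - x') (y - y').
Proof.
move=> xy xy' W U /(topscZ_linear (t := D))[V oV VW] oU.
have [V0 _ VB] := open_subgroupP oV; have [_ _ UB] := open_subgroupP oU.
have [a Va Ua] := xy V U V0 oU; have [b Vb Ub] := xy' V U V0 oU.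
have BE (Z : zmodType) (r s t u : Z) : r - s - (t - u) = (r - t) - (s - u).
  by rewrite !opprB addrACA [RHS]addrACA [- s + _]addrC.
by exists (a - b); [apply: VW|]; rewrite homZB BE; [apply: VB|apply: (UB)].
Qed.

Lemma graph_closure_graph a : graph_closure (p a) (g a).
Proof.
move=> W U /(@nbhs_singleton D) W0 /open_subgroupP[_ U0 _].
by exists a; rewrite subrr.
Qed.

Lemma hom_graph_closure (h : homZ D Y) :
  compZ h p = g -> forall x, graph_closure x (h x).
Proof.
move=> hp x W U W0 oU; have [U0 _ _] := open_subgroupP oU.
have hU : nbhs (0 : D) (h @^-1` U).
  by apply: homZ_continuous; rewrite homZ0.
have [a [Wa Ua]] := p_dense x (filterI W0 hU).
by exists a => //; rewrite -hp /= -homZB.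
Qed.

Lemma extension : exists! h : homZ D Y, compZ h p = g.
Proof.
have /choice[h hP] := graph_closure_total.
have hB : zmod_morphism h.
  move=> x y; apply: graph_closure_unique (hP _) _.
  exact: graph_closureB.
have hC : continuous h.
  apply: additive_continuous => // V /(topscZ_linear (t := Y))[U oU UV].
  have [W [oW Wg]] := controls_ex oU.
  have [U0 _ UB] := open_subgroupP oU; have [W0 _ _] := open_subgroupP oW.
  apply: (filterS _ W0) => x Wx; apply: UV.
  have [a Wa Ua] := hP x W U W0 oU.
  have -> : h x = g a - (g a - h x) by rewrite opprB addrC subrK.
  apply: (UB) => //; apply: Wg.
  by rewrite -(subrK x (p a)); apply: open_subgroupD.
have h_hom : h \in @cont_additive D Y by apply/cont_additiveP.
exists (HomZ h_hom); split=> [|h' h'p]; apply: homZ_ext => x /=.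
  exact: graph_closure_unique (hP _) (graph_closure_graph _).
exact: graph_closure_unique (hP _) (hom_graph_closure h'p _).
Qed.

End Extension.

(** * From topological groups to topological vector spaces *)

Section Forget.
Variable k : fieldType.

Lemma open_subspace_subgroup (V : topscK k) :
  @open_subspace k V `<=` @open_subgroup V.
Proof. by move=> U [Uo Usub]; split=> //; exact: GRing.submod_closedB Usub. Qed.

Lemma forget_linear (V : topscK k) : base_at_zero (@open_subgroup V).
Proof.
move=> W /(topscK_linear (t := V))[U oU UW].
by exists U => //; exact: open_subspace_subgroup.
Qed.

Lemma forget_complete (V : topscK k) : completion_complete (@open_subgroup V).
Proof.
apply: completion_complete_sub (@topscK_complete k V) => [|U [_]|U oU] //.
  exact: open_subspace_subgroup.
have [U0 _ _] := open_subgroupP oU.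
exact: (topscK_linear (t := V)).
Qed.

Definition forget (V : topscK k) : topscZ :=
  TopscZ (@forget_linear V)
    (completion_separated_sub (@open_subspace_subgroup V)
       (@topscK_separated k V))
    (@forget_complete V).

Lemma homK_linear (V W : topscK k) (f : homK V W) : linear f.
Proof. by have /cont_linearP[] := homK_spec f. Qed.

Lemma homK_additive (V W : topscK k) (f : homK V W) :
  (f : V -> W) \in @cont_additive (forget V) (forget W).
Proof.
have /cont_linearP[fL fC] := homK_spec f.
apply/cont_additiveP; split=> // x y.
by rewrite -[x - y]addrC -scaleN1r fL scaleN1r addrC.
Qed.

Definition forgetm (V W : topscK k) (f : homK V W) :
    homZ (forget V) (forget W) :=
  HomZ (homK_additive f).

Lemma homK_ext (V W : topscK k) (f g : homK V W) : f =1 g -> f = g.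
Proof. by move=> fg; apply/val_inj/funext. Qed.

Lemma forgetm_inj (V W : topscK k) : injective (@forgetm V W).
Proof.
move=> f g fg; apply: homK_ext => x.
exact: (congr1 (fun h : homZ _ _ => h x) fg).
Qed.

Lemma forgetm_comp (U V W : TopK_sc k) (f : Mor V W) (g : Mor U V) :
  forgetm (f \c g) =
  @compm TopZ_sc (forget U) (forget V) (forget W) (forgetm f) (forgetm g).
Proof. exact: homZ_ext. Qed.

Lemma forgetm0 (V W : TopK_sc k) :
  forgetm (0 : Mor V W) = 0 :> @Mor TopZ_sc (forget V) (forget W).
Proof. exact: homZ_ext. Qed.

Lemma scale_spec (V : topscK k) (a : k) :
  (fun x : V => a *: x) \in @cont_additive (forget V) (forget V).
Proof.
apply/cont_additiveP; split=> [x y|x]; first exact: scalerBr.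
apply: (@continuous_comp V (discrete_topology k * V)%type V
  (fun y => (a, y)) (fun z => (z.1 : k) *: z.2)).
  apply: (@cvg_pair _ _ _ _ (nbhs (a : discrete_topology k))).
    exact: cvg_cst.
  exact: cvg_id.
exact: topVect_scale_continuous.
Qed.

Definition scaleZ (V : topscK k) (a : k) : homZ (forget V) (forget V) :=
  HomZ (scale_spec V a).

(** Linearity of an additive [h] is an equation between two continuous
    homomorphisms for each scalar, so it can be checked after composition with a
    monomorphism or an epimorphism. *)
Lemma scalable_homK (V W : topscK k) (h : homZ (forget V) (forget W)) :
  (forall a, compZ h (scaleZ V a) = compZ (scaleZ W a) h) ->
  exists h' : homK V W, forgetm h' = h.
Proof.
move=> hS.
have h_lin : (h : V -> W) \in @cont_linear k V W.
  apply/cont_linearP; split; last exact: homZ_continuous.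
  move=> a x y; have ha : h (a *: x) = a *: h x.
    exact: (congr1 (fun u : homZ _ _ => u x) (hS a)).
  rewrite -ha -[y]opprK.
  have hN z : h (- z) = - h z by rewrite -sub0r homZB homZ0 sub0r.
  by rewrite [LHS]homZB hN !opprK.
by exists (HomK h_lin); apply: homZ_ext.
Qed.

Lemma scaleZ_natural (V W : topscK k) (f : homK V W) a :
  compZ (forgetm f) (scaleZ V a) = compZ (scaleZ W a) (forgetm f).
Proof.
apply: homZ_ext => x; rewrite -[LHS]/(f (a *: x)) -[RHS]/(a *: f x).
rewrite -[a *: x in LHS]addr0 (homK_linear f).
by rewrite [X in _ + X](homZ0 (forgetm f)) addr0.
Qed.

(** The factorization [h] of a linear [g] through [i] commutes with scalars,
    because it does so after composition with the monomorphism [i]. *)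
Lemma forget_reflects_kernel (K V W : TopK_sc k) (f : Mor V W) (i : Mor K V) :
  @is_kernel TopZ_sc (forget K) (forget V) (forget W) (forgetm f) (forgetm i) ->
  is_kernel f i.
Proof.
move=> [fi0 iU]; split=> [|X g fg0].
  by apply: forgetm_inj; rewrite forgetm_comp fi0 forgetm0.
have [|h [ih hU]] := iU (forget X) (forgetm g).
  by rewrite -forgetm_comp fg0 forgetm0.
have i_mono (u v : homZ (forget X) (forget K)) :
    compZ (forgetm i) u = compZ (forgetm i) v -> u = v.
  move=> uv.
  have [|w [_ wU]] := iU (forget X) (compZ (forgetm i) v).
    by rewrite [LHS](@compm_assoc TopZ_sc) fi0 (@comp0m TopZ_sc).
  by rewrite -(wU u uv) -(wU v erefl).
have [a|h' h'E] := @scalable_homK _ _ h.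
  apply: i_mono; rewrite !compZ_assoc (ih : compZ _ _ = _) !scaleZ_natural.
  by rewrite -compZ_assoc (ih : compZ _ _ = _).
exists h'; split=> [|u iu]; apply: forgetm_inj.
  by rewrite forgetm_comp h'E.
by rewrite h'E; apply: hU; rewrite -iu -forgetm_comp.
Qed.

(** Dual to the case of kernels, with the epimorphism [p] in place of the
    monomorphism [i]. *)
Lemma forget_reflects_cokernel (V W Q : TopK_sc k) (f : Mor V W) (p : Mor W Q) :
  @is_cokernel TopZ_sc (forget V) (forget W) (forget Q)
    (forgetm f) (forgetm p) ->
  is_cokernel f p.
Proof.
move=> cok; have [pf0 pU] := cok; split=> [|X g gf0].
  by apply: forgetm_inj; rewrite forgetm_comp pf0 forgetm0.
have [|h [hp hU]] := pU (forget X) (forgetm g).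
  by rewrite -forgetm_comp gf0 forgetm0.
have [a|h' h'E] := @scalable_homK _ _ h.
  apply: (cokernel_epi cok); rewrite -[LHS]compZ_assoc -[RHS]compZ_assoc.
  rewrite -scaleZ_natural compZ_assoc (hp : compZ _ _ = _).
  by rewrite scaleZ_natural.
exists h'; split=> [|u up]; apply: forgetm_inj.
  by rewrite forgetm_comp h'E.
by rewrite h'E; apply: hU; rewrite -up -forgetm_comp.
Qed.

End Forget.

(** * Countability *)

Lemma countable_subset T (A B : set T) : A `<=` B -> countable B -> countable A.
Proof. by move=> AB; apply: sub_countable; apply: subset_card_le. Qed.

Lemma uncountable_set_nat : ~ countable [set: set nat].
Proof.
move=> /countable_injP[f f_inj].
pose d : set nat := [set n | forall x, f x = n -> ~ x n].
have dN : ~ d (f d) by move=> dd; exact: (dd d).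
apply: (dN) => x fx; have -> : x = d by apply: f_inj; rewrite ?inE.
exact: dN.
Qed.

(** * Products of copies of the field *)

Section Construction.
Variable k : fieldType.

(** With no condition on the functions, locality is automatic: these are
    products of copies of [k]. *)
Definition full_spec (X : Type) (T : set (set X)) (T0 : T !=set0)
    (TU : forall D E, T D -> T E -> T (D `|` E))
    (Tx : forall x, exists2 D, T D & D x) : fun_spec k.
Proof.
refine (@FunSpec k X T predT T0 TU Tx _ _) => // f _.
Defined.

Definition discrete_spec (X : Type) : fun_spec k.
Proof.
by refine (@full_spec X setT _ _ _) => // [|x]; exists setT.
Defined.

(** The product topology on [k^nat]: the test sets are the bounded sets. *)
Definition seq_spec : fun_spec k.
Proof.
refine (@full_spec nat [set D | exists n, D `<=` `I_n] _ _ _).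
- by exists set0, 0%N.
- move=> D E [m Dm] [n En]; exists (maxn m n) => x [/Dm|/En] /= lt_x.
    exact: leq_trans lt_x (leq_maxl _ _).
  exact: leq_trans lt_x (leq_maxr _ _).
- by move=> n; exists `I_n.+1 => //=; exists n.+1.
Defined.

(** * Continuous linear maps between function spaces *)

Section Map.
Variables (s t : fun_spec k) (f : fspace s -> fspace t).
Hypothesis f_linear : linear f.
Hypothesis f_vanishing : forall E : set (pts t), tests E ->
  exists2 D : set (pts s), tests D &
    forall a : fspace s, {in D, forall x, a x = 0} ->
    {in E, forall y, f a y = 0}.

Lemma fspace_map_spec :
  (f : fspace_topsc s -> fspace_topsc t) \in
    @cont_linear k (fspace_topsc s) (fspace_topsc t).
Proof.
apply/cont_linearP; split=> //; apply: additive_continuous => [x y|V].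
  by rewrite -[x - y]addrC -scaleN1r f_linear scaleN1r addrC.
move=> /nbhs0_vanishing[E tE EV]; have [D tD DE] := f_vanishing tE.
exists D => // a a0; apply: EV; exact: DE.
Qed.

Definition fspace_map : homK (fspace_topsc s) (fspace_topsc t) :=
  HomK fspace_map_spec.

End Map.

(** * Finitely supported functions and thin sets *)

Variable I : choiceType.
Hypothesis I_uncountable : ~ countable [set: I].

Definition finsupp (a : I * nat -> k^o) := finite_set [set q | a q != 0].

Definition col_sum (a : I * nat -> k^o) (n : nat) : k^o :=
  \sum_(i \in [set: I]) a (i, n).

Lemma finsupp0 : finsupp 0.
Proof.
rewrite /finsupp (_ : mkset _ = set0) //.
by apply/seteqP; split=> q //=; rewrite eqxx.
Qed.

Lemma finsuppP c a b : finsupp a -> finsupp b -> finsupp (c *: a + b).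
Proof.
move=> fa fb; apply: (@sub_finite_set _ _
  ([set q | a q != 0] `|` [set q | b q != 0])).
  move=> q /=; rewrite -[(c *: a + b) q]/(c * a q + b q).
  have [->|] := eqVneq (a q) 0; last by left.
  by rewrite mulr0 add0r; right.
by rewrite finite_setU.
Qed.

(** The sum over the infinite set [I] is additive because the three sums
    involved can be taken over a common finite set. *)
Lemma col_sum_linear c a b : finsupp a -> finsupp b ->
  col_sum (c *: a + b) =  c *: col_sum a + col_sum b.
Proof.
move=> fa fb; apply/funext => n.
pose S := [set q.1 | q in [set q | a q != 0] `|` [set q | b q != 0]].
have finS : finite_set S by apply: finite_image; rewrite finite_setU.
have SE (f : I * nat -> k^o) : (forall q, ~ S q.1 -> f q = 0) ->
    col_sum f n = \sum_(i \in S) f (i, n).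
  by move=> f0; apply/esym/fsbig_widen => // i [_ Si]; rewrite /= f0.
have a0 q : ~ S q.1 -> a q = 0.
  move=> Sq; apply/eqP/negP => aq; apply: Sq.
  by exists q => //; left; apply/negP.
have b0 q : ~ S q.1 -> b q = 0.
  move=> Sq; apply/eqP/negP => bq; apply: Sq.
  by exists q => //; right; apply/negP.
rewrite -[RHS]/(c * col_sum a n + col_sum b n) !SE //; last first.
  by move=> q Sq; rewrite -[LHS]/(c * a q + b q) a0 // b0 // mulr0 addr0.
by rewrite mulr_fsumr -fsbig_split.
Qed.

(** Countable test sets make the space of finitely supported functions complete;
    the first [n] columns are allowed so that summation over [I] is continuous
    for the product topology. *)
Definition thin : set (set (I * nat)) :=
  [set D | exists n, countable [set q | D q /\ (n <= q.2)%N]].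

Lemma thin0 : thin !=set0.
Proof.
exists set0, 0%N; rewrite (_ : mkset _ = set0) //.
by apply/seteqP; split=> q // [].
Qed.

Lemma thinU D E : thin D -> thin E -> thin (D `|` E).
Proof.
move=> [m cD] [n cE]; exists (maxn m n).
apply: (@countable_subset _ _ ([set q | D q /\ (m <= q.2)%N] `|`
   [set q | E q /\ (n <= q.2)%N])); last first.
  by rewrite -bigcup2inE; apply: bigcup_countable => // -[|[|]].
by move=> q [[Dq|Eq]]; rewrite geq_max => /andP[mq nq]; [left|right].
Qed.

Lemma countable_thin D : countable D -> thin D.
Proof. by move=> cD; exists 0%N; apply: countable_subset cD => q []. Qed.

Lemma strip_thin n : thin [set q | (q.2 < n)%N].
Proof.
exists n; rewrite (_ : mkset _ = set0) //.
by apply/seteqP; split=> q //= [qn /(leq_trans qn)]; rewrite ltnn.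
Qed.

Lemma thin_cover q : exists2 D, thin D & D q.
Proof. by exists [set q] => //; apply: countable_thin; apply: countable1. Qed.

(** An infinite support would contain a countably infinite set; this set is
    thin, and on it the function agrees with a finitely supported one. *)
Lemma finsupp_local a :
  (forall D, thin D -> exists2 b, finsupp b & {in D, b =1 a}) -> finsupp a.
Proof.
move=> a_loc; apply: contrapT => /infiniteP/card_subP[C C_nat Ca].
have cC : countable C by rewrite (eq_countable C_nat).
have [b fb ba] := a_loc C (countable_thin cC).
have : finite_set C.
  apply: sub_finite_set fb => q Cq /=.
  by rewrite ba ?inE //; exact: Ca.
by rewrite (eq_finite_set C_nat); exact: infinite_nat.
Qed.

(** The whole column [I * {n}] is thin, so the local condition already
    determines the sum over it. *)
Lemma col_sum_local a : (forall D, thin D ->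
  exists2 b, forall n, col_sum b n = 0 & {in D, b =1 a}) ->
  forall n, col_sum a n = 0.
Proof.
move=> a_loc n; have [b b0 ba] := a_loc _ (strip_thin n.+1).
by rewrite -(b0 n); apply: eq_fsbigr => i _; rewrite ba // inE /=.
Qed.

Definition finsuppb : {pred (I * nat -> k^o)} := [pred a | `[< finsupp a >]].

Definition col_sum_zero : {pred (I * nat -> k^o)} :=
  [pred a | `[< finsupp a /\ forall n, col_sum a n = 0 >]].

Definition finsupp_spec : fun_spec k.
Proof.
refine (@FunSpec k _ thin finsuppb thin0 thinU thin_cover _ _).
- split=> [|c a b]; first exact/asboolP/finsupp0.
  by move=> /asboolP fa /asboolP fb; apply/asboolP/finsuppP.
- move=> a a_loc; apply/asboolP/finsupp_local => D /a_loc[b /asboolP fb ba].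
  by exists b.
Defined.

Lemma col_sum0 n : col_sum 0 n = 0.
Proof. by apply: fsbig1. Qed.

Definition col_sum_zero_spec : fun_spec k.
Proof.
refine (@FunSpec k _ thin col_sum_zero thin0 thinU thin_cover _ _).
- split=> [|c a b].
    by apply/asboolP; split; [exact: finsupp0|exact: col_sum0].
  move=> /asboolP[fa a0] /asboolP[fb b0]; apply/asboolP.
  split=> [|n]; first exact: finsuppP.
  rewrite col_sum_linear // -[LHS]/(c * col_sum a n + col_sum b n) a0 b0.
  by rewrite mulr0 addr0.
- move=> a a_loc; apply/asboolP; split.
    by apply/finsupp_local => D /a_loc[b /asboolP[fb _] ba]; exists b.
  by apply/col_sum_local => D /a_loc[b /asboolP[_ b0] ba]; exists b.
Defined.

Lemma fspace_finsupp (a : fspace finsupp_spec) : finsupp a.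
Proof. by have /asboolP := fvalP a. Qed.

Definition mk_finsupp a (fa : finsupp a) : fspace finsupp_spec :=
  @Fspace k finsupp_spec a (asboolT fa).

Definition mk_seq (v : nat -> k^o) : fspace seq_spec :=
  @Fspace k seq_spec v erefl.

Lemma col_sum_zeroP (a : fspace col_sum_zero_spec) :
  finsupp a /\ forall n, col_sum a n = 0.
Proof. by have /asboolP := fvalP a. Qed.

(** * The maps of the counterexample *)

Definition incl_fun (a : fspace col_sum_zero_spec) : fspace finsupp_spec :=
  mk_finsupp (col_sum_zeroP a).1.

Definition sum_fun (a : fspace finsupp_spec) : fspace seq_spec :=
  mk_seq (col_sum a).

Definition diff_fun (x : fspace seq_spec) : fspace seq_spec :=
  mk_seq (fun n => x n.+1 - x n).

Definition const_fun (c : fspace (discrete_spec unit)) : fspace seq_spec :=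
  mk_seq (fun=> c tt).

Lemma incl_linear : linear incl_fun.
Proof. by move=> c a b; apply/val_inj. Qed.

Lemma sum_linear : linear sum_fun.
Proof.
move=> c a b; apply/val_inj.
rewrite -[LHS]/(col_sum (c *: fval a + fval b)).
by rewrite col_sum_linear //; exact: fspace_finsupp.
Qed.

Lemma diff_linear : linear diff_fun.
Proof.
move=> c x y; apply/val_inj/funext => n.
rewrite -[LHS]/(c * x n.+1 + y n.+1 - (c * x n + y n)).
by rewrite -[RHS]/(c * (x n.+1 - x n) + (y n.+1 - y n)) mulrBr opprD addrACA.
Qed.

Lemma const_linear : linear const_fun.
Proof. by move=> c x y; apply/val_inj. Qed.

Lemma incl_vanishing (E : set (I * nat)) : thin E -> exists2 D, thin D &
  forall a : fspace col_sum_zero_spec, {in D, forall q, a q = 0} ->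
  {in E, forall q, incl_fun a q = 0}.
Proof. by exists E. Qed.

Lemma sum_vanishing (E : set nat) : @tests k seq_spec E -> exists2 D, thin D &
  forall a : fspace finsupp_spec, {in D, forall q, a q = 0} ->
  {in E, forall n, sum_fun a n = 0}.
Proof.
move=> [n En]; exists [set q | (q.2 < n)%N] => [|a a0 m /set_mem/En mn].
  exact: strip_thin.
by apply: fsbig1 => i _; apply: a0; rewrite inE.
Qed.

Lemma diff_vanishing (E : set nat) : @tests k seq_spec E ->
  exists2 D, @tests k seq_spec D &
  forall x : fspace seq_spec, {in D, forall n, x n = 0} ->
  {in E, forall n, diff_fun x n = 0}.
Proof.
move=> [n En]; exists `I_n.+1 => [|x x0 m /set_mem/En mn]; first by exists n.+1.
by rewrite /= !x0 ?subrr // inE //=; apply: ltnW.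
Qed.

Lemma const_vanishing (E : set nat) : @tests k seq_spec E ->
  exists2 D, @tests k (discrete_spec unit) D &
  forall c : fspace (discrete_spec unit), {in D, forall n, c n = 0} ->
  {in E, forall n, const_fun c n = 0}.
Proof. by move=> _; exists setT => // c c0 m _; apply: c0; rewrite inE. Qed.

Definition incl_hom := fspace_map incl_linear incl_vanishing.
Definition sum_hom := fspace_map sum_linear sum_vanishing.
Definition diff_hom := fspace_map diff_linear diff_vanishing.
Definition const_hom := fspace_map const_linear const_vanishing.

Local Notation A := (fspace_topsc finsupp_spec).
Local Notation K := (fspace_topsc col_sum_zero_spec).
Local Notation S := (fspace_topsc seq_spec).

Lemma finsupp_bound a : finsupp a ->
  exists n, forall i m, (n <= m)%N -> a (i, m) = 0.
Proof.
move=> /finite_seqP[r ra].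
exists (\max_(q <- r) q.2.+1)%N => i m nm; apply/eqP/negPn/negP => aq.
have rq : (i, m) \in r.
  by have : [set q | a q != 0] (i, m) by []; rewrite ra.
have := @leq_bigmax_seq _ r xpredT (fun q => q.2.+1) _ rq isT.
by move=> /leq_trans/(_ nm); rewrite ltnn.
Qed.

(** The image of the summation map contains no nonzero constant sequence,
    because the sums over all but finitely many columns vanish. *)
Lemma col_sum_const a : finsupp a -> (forall n, col_sum a n.+1 = col_sum a n) ->
  forall n, col_sum a n = 0.
Proof.
move=> /finsupp_bound[n an] aS m.
have aE j : col_sum a (m + j) = col_sum a m.
  by elim: j => [|j IH]; rewrite ?addn0 ?addnS ?aS.
by rewrite -(aE n); apply: fsbig1 => i _; apply: an; exact: leq_addl.
Qed.

(** By [col_sum_const], the composite of differences with summation has the same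
    kernel as summation. *)
Lemma incl_kernel :
  @is_kernel TopZ_sc (forget K) (forget A) (forget S)
    (compZ (forgetm diff_hom) (forgetm sum_hom)) (forgetm incl_hom).
Proof.
split=> [|X g g0].
  apply: homZ_ext => a; apply/val_inj/funext => n.
  by rewrite -[LHS]/(col_sum a n.+1 - col_sum a n) !(col_sum_zeroP a).2 subrr.
have gP x : `[< finsupp (g x) /\ forall n, col_sum (g x) n = 0 >].
  have fg := fspace_finsupp (g x).
  apply/asboolP; split=> //; apply: col_sum_const => // n.
  apply/eqP; rewrite -subr_eq0; apply/eqP.
  exact: (congr1 (fun h : homZ _ (forget S) => (h x : fspace seq_spec) n) g0).
pose h x := @Fspace k col_sum_zero_spec (g x) (gP x).
have h_hom : h \in @cont_additive X (forget K).
  have hB : zmod_morphism h.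
    by move=> x y; apply/val_inj; rewrite /= (homZB g).
  apply/cont_additiveP; split=> //.
  apply: additive_continuous => // V /nbhs0_vanishing[D tD DV].
  have : nbhs (0 : X) (g @^-1` vanishing (s := finsupp_spec) D).
    apply: homZ_continuous; rewrite (homZ0 g).
      exact: (@vanishing_nbhs0 k finsupp_spec).
  by apply: filterS => x gx; apply: DV.
exists (HomZ h_hom); split=> [|u iu]; apply: homZ_ext => x; apply/val_inj => //.
exact: esym (congr1 (fun h : homZ X (forget A) => fval (h x)) iu).
Qed.

(** A sequence placed on the row [{i} * nat]: a section of the summation map on
    finitely supported sequences, one for each [i]. *)
Definition row (i : I) (v : nat -> k^o) : I * nat -> k^o :=
  fun q => if q.1 == i then v q.2 else 0.

Lemma finsupp_row i v n :
  (forall m, (n <= m)%N -> v m = 0) -> finsupp (row i v).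
Proof.
move=> vn; apply: (@sub_finite_set _ _ ([set i] `*` `I_n)).
  move=> [j m]; rewrite /row /=.
  case: (eqVneq j i) => [->|_]; last by rewrite eqxx.
  by move=> vm; split=> //; rewrite ltnNge; apply: contraNN vm => /vn ->.
by apply: finite_setX => //; exact: finite_II.
Qed.

Lemma col_sum_row i v : col_sum (row i v) = v.
Proof.
apply/funext => n; rewrite /col_sum -(fsbig_widen [set i]) //.
  by rewrite fsbig_set1 /row eqxx.
by move=> j [_ /eqP/negPf ji]; rewrite /= /row ji.
Qed.

(** Only countably many rows meet the countable part of a thin set. *)
Lemma thin_free_row D : thin D ->
  exists i n, forall m, D (i, m) -> (m < n)%N.
Proof.
move=> [n cD]; pose R := fst @` [set q | D q /\ (n <= q.2)%N].
have cR : countable R by apply: sub_countable cD; exact: card_image_le.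
have [i Ri] : exists i, ~ R i.
  apply: contrapT => /forallNP Ri; apply: I_uncountable.
  by apply: countable_subset cR => i _; apply: contrapT (Ri i).
exists i, n => m Dim; rewrite ltnNge; apply/negP => nm.
by apply: Ri; exists (i, m).
Qed.

(** Let [g] vanish on the kernel of the summation map. Then [g a] depends only
    on the sums of [a], and [a] may be replaced by the function with the same
    sums that is supported on one row. If the first [n] sums are zero and the
    row is free of a thin set [D] from column [n] on, the new function vanishes
    on [D]. So [g] is continuous for the product topology on the sums, and
    [extension] applies. *)
Lemma sum_cokernel :
  @is_cokernel TopZ_sc (forget K) (forget A) (forget S)
    (forgetm incl_hom) (forgetm sum_hom).
Proof.
split=> [|Y g g0].
  apply: homZ_ext => a; apply/val_inj/funext => n.
  exact: (col_sum_zeroP a).2.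
have gK (a : fspace finsupp_spec) : (forall n, col_sum a n = 0) -> g a = 0.
  move=> a0; have aP : `[< finsupp a /\ forall n, col_sum a n = 0 >].
    by apply/asboolP; split=> //; exact: fspace_finsupp.
  have -> : a = incl_hom (@Fspace k col_sum_zero_spec a aP) by apply/val_inj.
  exact: (congr1 (fun h : homZ (forget K) _ => h _) g0).
have [i0 _] := thin_free_row (countable_thin (countable0 _)).
apply: extension => [x W /nbhs0_vanishing[D [n Dn] DW]|U oU].
(* Density: the first [n] terms of [x], placed on any row. *)
- pose v m := if (m < n)%N then (x : fspace seq_spec) m else 0.
  have fv : finsupp (row i0 v).
    by apply: (@finsupp_row _ _ n) => m; rewrite /v leqNgt => /negPf ->.
  exists (mk_finsupp fv); apply: DW => m /set_mem/Dn mn.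
  rewrite -[LHS]/(col_sum (row i0 v) m - (x : fspace seq_spec) m).
  by rewrite col_sum_row /v mn subrr.
have [U0 _ _] := open_subgroupP oU.
have := @homZ_continuous _ _ g 0 U; rewrite (homZ0 g) => /(_ U0).
move=> /nbhs0_vanishing[D tD DU].
(* The index [i] is chosen after [D]: no single row is free of all thin sets. *)
have [i [n iD]] := thin_free_row tD.
exists (vanishing (s := seq_spec) `I_n).
  have tn : @tests k seq_spec `I_n by exists n.
  exact: vanishing_nbhs0 tn.
move=> a an.
have [b ab] : exists b : fspace finsupp_spec, fval b = row i (col_sum a).
  have [l al] := finsupp_bound (fspace_finsupp a).
  have fb : finsupp (row i (col_sum a)).
    by apply: (@finsupp_row _ _ l) => m lm; apply: fsbig1 => j _; exact: al.
  by exists (mk_finsupp fb).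
have -> : g a = g b.
  apply/eqP; rewrite -subr_eq0 -(homZB g); apply/eqP/gK => m.
  rewrite (_ : fval (a - b) = - 1 *: fval b + fval a).
    rewrite col_sum_linear; [|exact: fspace_finsupp..].
    rewrite ab col_sum_row -[LHS]/(- 1 * col_sum a m + col_sum a m).
    by rewrite mulN1r addNr.
  by rewrite scaleN1r addrC.
apply: DU => -[j m] /set_mem Djm; rewrite ab /row /=.
by case: eqP => // ji; apply: an; rewrite inE /=; apply: iD; rewrite -ji.
Qed.

Lemma diff_surjective (y : S) : exists x, diff_hom x = y.
Proof.
exists (mk_seq (fun n => \sum_(j < n) (y : fspace seq_spec) j)).
apply/val_inj/funext => n.
rewrite -[LHS]/(\sum_(j < n.+1) _ - \sum_(j < n) _) big_ord_recr /=.
by rewrite addrAC subrr add0r.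
Qed.

Local Notation L := (fspace_topsc (discrete_spec unit)).
Local Notation O := (fspace_topsc (discrete_spec void)).

Lemma const_injective : injective const_hom.
Proof.
move=> c d cd; apply/val_inj/funext => -[].
exact: (congr1 (fun x : fspace seq_spec => x 0%N) cd).
Qed.

Lemma diff_const c : diff_hom (const_hom c) = 0.
Proof. by apply/val_inj/funext => n; exact: subrr. Qed.

Lemma L_neq0 : exists c : L, c <> 0.
Proof.
exists (@Fspace k (discrete_spec unit) (fun=> 1) erefl).
move=> /(congr1 (fun c : fspace (discrete_spec unit) => c tt)) /eqP.
by rewrite oner_eq0.
Qed.

Lemma O_eq0 (x : O) : x = 0.
Proof. by apply/val_inj/funext => -[]. Qed.

(** * The counterexample in both categories *)

Lemma counterexampleZ : coimage_counterexample TopZ_sc.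
Proof.
apply: (@CoimageCounterexample TopZ_sc (forget K) (forget A) (forget S)
  (forget S) (forget L) (forget O) (forgetm incl_hom) (forgetm sum_hom)
  (forgetm diff_hom) (forgetm const_hom)).
- exact: sum_cokernel.
- exact: incl_kernel.
- move=> Y g h gh; apply: homZ_ext => y; have [x <-] := diff_surjective y.
  exact: (congr1 (fun u : homZ (forget S) Y => u x) gh).
- move=> X g h gh; apply: homZ_ext => x; apply: const_injective.
  exact: (congr1 (fun u : homZ X (forget S) => u x) gh).
- by apply: homZ_ext => c; exact: diff_const.
- have [c c0] := L_neq0.
  by move=> /(congr1 (fun u : homZ (forget L) (forget L) => u c)).
- by apply: homZ_ext => x; exact: O_eq0.
Qed.

Lemma counterexampleK : coimage_counterexample (TopK_sc k).
Proof.
apply: (@CoimageCounterexample (TopK_sc k) K A S S L O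
  incl_hom sum_hom diff_hom const_hom).
- exact/forget_reflects_cokernel/sum_cokernel.
- by apply: forget_reflects_kernel; rewrite forgetm_comp; exact: incl_kernel.
- move=> Y g h gh; apply: homK_ext => y; have [x <-] := diff_surjective y.
  exact: (congr1 (fun u : homK S Y => u x) gh).
- move=> X g h gh; apply: homK_ext => x; apply: const_injective.
  exact: (congr1 (fun u : homK X S => u x) gh).
- by apply: homK_ext => c; exact: diff_const.
- have [c c0] := L_neq0.
  by move=> /(congr1 (fun u : homK L L => u c)).
- by apply: homK_ext => x; exact: O_eq0.
Qed.

End Construction.

Theorem corollary8p6 (k : fieldType) :
  (~ left_quasi_abelian TopZ_sc /\ ~ left_quasi_abelian (TopK_sc k)) /\
  (~ left_semi_abelian TopZ_sc /\ ~ left_semi_abelian (TopK_sc k)).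
Proof.
have exZ := counterexampleZ k uncountable_set_nat.
have exK := counterexampleK k uncountable_set_nat.
split; split; first [exact: counterexample_not_quasi_abelian
                    |exact: counterexample_not_semi_abelian].
Qed.
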